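(* Let $(X,\le)$ be a finite poset, $K$ a field, and let $\mathcal{J}=J(I(X,K))$ be the Jacobson radical of the incidence algebra $I(X,K)$, with its product $\cdot$. Then a product $*$ on $\mathcal{J}$ is a totally compatible structure on $(\mathcal{J},\cdot)$ if and only if it is of the form $$*=\bullet+\sum_{\mathcal{C}\in X^3_</{\approx}}\alpha_{\mathcal{C}}\,*_{\mathcal{C}},$$ where $\bullet$ is an annihilator-valued structure on $(\mathcal{J},\cdot)$ and $\alpha_{\mathcal{C}}\in K$ for each $\approx$-equivalence class $\mathcal{C}$ of $X^3_<$.
   Context: All products on $K$-vector spaces are $K$-bilinear; sums and scalar multiples of products are taken pointwise. The incidence algebra $I(X,K)$ is the associative $K$-algebra with basis $\{e_{xy}: x,y\in X,\ x\le y\}$ and multiplication $e_{xy}\cdot e_{uv}=\delta_{yu}e_{xv}$ ($\delta$ is the Kronecker delta). Its Jacobson radical is $\mathcal{J}=\mathrm{span}_K\{e_{xy}: x<y\}$. Two products $\cdot_1,\cdot_2$ on a vector space $V$ are totally compatible if $(a\cdot_1 b)\cdot_2 c=(a\cdot_2 b)\cdot_1 c=a\cdot_1(b\cdot_2 c)=a\cdot_2(b\cdot_1 c)$ for all $a,b,c\in V$. A totally compatible structure on an associative algebra $(A,\cdot)$ is an associative bilinear product $*$ on $A$ such that $\cdot$ and $*$ are totally compatible. A bilinear product $\bullet$ on $A$ is annihilator-valued (with respect to $\cdot$) if $(A\cdot A)\bullet A=(A\bullet A)\cdot A=A\cdot(A\bullet A)=A\bullet(A\cdot A)=\{0\}$,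 where $B\cdot C=\mathrm{span}_K\{b\cdot c: b\in B,c\in C\}$ (similarly for $\bullet$). An annihilator-valued structure on $(A,\cdot)$ is an associative annihilator-valued bilinear product on $A$. $X^3_<=\{(x,y,z)\in X^3: x<y<z\}$. A chain in $X$ is a nonempty subset of pairwise comparable elements. Triples $(x,y,z),(u,v,w)\in X^3_<$ are chained if there is a chain in $X$ containing all of $x,y,z,u,v,w$. $\approx$ is the equivalence relation on $X^3_<$ generated by all pairs of chained triples, and $X^3_</{\approx}$ is the set of its classes. For a class $\mathcal{C}\in X^3_</{\approx}$, $*_{\mathcal{C}}$ is the bilinear product on $\mathcal{J}$ given, for $x<y$ and $u<v$, by $e_{xy}*_{\mathcal{C}}e_{uv}=e_{xv}$ if $y=u$ and $(x,y,v)\in\mathcal{C}$, and $e_{xy}*_{\mathcal{C}}e_{uv}=0$ otherwise. *)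

(* Defs.v *)
From HB Require Import structures.
From mathcomp Require Import all_boot all_order all_algebra sesquilinear.

Set Implicit Arguments.
Unset Strict Implicit.
Unset Printing Implicit Defensive.

Import Order.TTheory GRing.Theory.
Local Open Scope ring_scope.

Section Products.
Variables (K : fieldType) (V : lmodType K).
Implicit Types (op mul bul : V -> V -> V) (A B C : V -> Prop).

Definition totally_compatible op1 op2 :=
  forall a b c : V,
    [/\ op2 (op1 a b) c = op1 (op2 a b) c,
        op1 (op2 a b) c = op1 a (op2 b c)
      & op1 a (op2 b c) = op2 a (op1 b c)].

Definition tc_structure mul (star : {bilinear V -> V -> V}) :=
  associative star /\ totally_compatible mul star.

Definition lin_span (S : V -> Prop) : V -> Prop := fun v =>
  exists (n : nat) (k : 'I_n -> K) (u : 'I_n -> V),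
    (forall i, S (u i)) /\ v = \sum_(i < n) k i *: u i.

Definition prod_span op B C : V -> Prop :=
  lin_span (fun v => exists b c : V, [/\ B b, C c & v = op b c]).

Definition whole : V -> Prop := fun _ => True.

Definition is_zero_space A := forall v : V, A v <-> v = 0.

Definition annihilator_valued mul bul :=
  [/\ is_zero_space (prod_span bul (prod_span mul whole whole) whole),
      is_zero_space (prod_span mul (prod_span bul whole whole) whole),
      is_zero_space (prod_span mul whole (prod_span bul whole whole))
    & is_zero_space (prod_span bul whole (prod_span mul whole whole))].

Definition annihilator_valued_structure mul (bul : {bilinear V -> V -> V}) :=
  associative bul /\ annihilator_valued mul bul.

End Products.

Section Incidence.
Variables (K : fieldType) (d : Order.disp_t) (X : finPOrderType d).

Definition interval : predArgType := {p : X * X | (p.1 <= p.2)%O}.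

Definition incidence : vectType K := {ffun interval -> K^o}.

(* The basis vector e_xy when x <= y, and 0 otherwise. *)
Definition inc_e (x y : X) : incidence := [ffun p => (val p == (x, y))%:R].

(* Bilinear extension of a map given on pairs of basis vectors; [a p] is the
   coordinate of [a] on e_xy for p = (x, y). *)
Definition bilin_ext (B : interval -> interval -> incidence)
    (a b : incidence) : incidence :=
  \sum_(p : interval) \sum_(q : interval) (a p * b q) *: B p q.

Definition inc_mul : incidence -> incidence -> incidence :=
  bilin_ext (fun p q =>
    ((val p).2 == (val q).1)%:R *: inc_e (val p).1 (val q).2).

Definition inc_one : incidence := \sum_(x : X) inc_e x x.

Definition radical : {vspace incidence} :=
  <<[seq inc_e p.1 p.2 | p : X * X in [pred p : X * X | (p.1 < p.2)%O]]>>%VS.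

Definition J : vectType K := subvs_of radical.

(* X^3_<, with a triple (x, y, z) encoded as ((x, y), z). *)
Definition triples : {set X * X * X} :=
  [set t | (t.1.1 < t.1.2)%O && (t.1.2 < t.2)%O].

Definition is_chain (c : {set X}) : bool :=
  (c != set0) && [forall x in c, forall y in c, (x >=< y)%O].

Definition chained (s t : X * X * X) : bool :=
  [&& s \in triples, t \in triples &
    [exists c : {set X}, is_chain c &&
      all [in c] [:: s.1.1; s.1.2; s.2; t.1.1; t.1.2; t.2]]].

(* [chained] is symmetric (lemma [chained_sym]), so its reflexive transitive
   closure is the equivalence relation it generates. *)
Definition approx : rel (X * X * X) := connect chained.

Definition triple_classes : {set {set X * X * X}} :=
  equivalence_partition approx triples.

Definition inc_star (C : {set X * X * X}) :
    incidence -> incidence -> incidence :=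
  bilin_ext (fun p q =>
    if [&& ((val p).1 < (val p).2)%O, ((val q).1 < (val q).2)%O,
           (val p).2 == (val q).1 & ((val p).1, (val p).2, (val q).2) \in C]
    then inc_e (val p).1 (val q).2 else 0).

Lemma inc_eE x y (p : interval) : inc_e x y p = (val p == (x, y))%:R.
Proof. by rewrite ffunE. Qed.

Lemma inc_e_val (p q : interval) : inc_e (val p).1 (val p).2 q = (q == p)%:R.
Proof. by rewrite inc_eE -surjective_pairing. Qed.

Lemma inc_decomp (a : incidence) :
  a = \sum_(p : interval) a p *: inc_e (val p).1 (val p).2.
Proof.
apply/ffunP => q; rewrite sum_ffunE (bigD1 q) //= big1 ?addr0 => [|p npq].
  by rewrite ffunE inc_e_val eqxx /GRing.scale /= mulr1.
by rewrite ffunE inc_e_val eq_sym (negPf npq) scaler0.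
Qed.

Lemma bilin_ext_bilinear B : bilinear_for *:%R *:%R (bilin_ext B).
Proof.
split=> [b k a a' | a k b b'] /=; rewrite /applyr /bilin_ext /=.
  rewrite scaler_sumr -big_split; apply: eq_bigr => p _ /=.
  rewrite scaler_sumr -big_split; apply: eq_bigr => q _ /=.
  by rewrite !ffunE mulrDl scalerDl scalerA mulrA.
rewrite scaler_sumr -big_split; apply: eq_bigr => p _ /=.
rewrite scaler_sumr -big_split; apply: eq_bigr => q _ /=.
by rewrite !ffunE mulrDr scalerDl scalerA mulrCA.
Qed.

HB.instance Definition _ B :=
  bilinear_isBilinear.Build K incidence incidence incidence *:%R *:%R
    (bilin_ext B) (bilin_ext_bilinear B).
HB.instance Definition _ := Bilinear.on inc_mul.
HB.instance Definition _ C := Bilinear.on (inc_star C).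

Lemma bilin_ext_e B (p q : interval) :
  bilin_ext B (inc_e (val p).1 (val p).2) (inc_e (val q).1 (val q).2) = B p q.
Proof.
rewrite /bilin_ext (bigD1 p) //= (bigD1 q) //= !inc_e_val !eqxx mulr1 scale1r.
rewrite !big1 ?addr0 // => [p' np|q' nq].
  by rewrite big1 // => q' _; rewrite inc_e_val (negPf np) mul0r scale0r.
by rewrite !inc_e_val (negPf nq) mulr0 scale0r.
Qed.

Lemma inc_mul_e x y u v : (x <= y)%O -> (u <= v)%O ->
  inc_mul (inc_e x y) (inc_e u v) = (y == u)%:R *: inc_e x v.
Proof.
move=> xy uv; pose p : interval := exist _ (x, y) xy.
pose q : interval := exist _ (u, v) uv.
rewrite [LHS](_ : _ = inc_mul (inc_e (val p).1 (val p).2)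
  (inc_e (val q).1 (val q).2)) //.
by rewrite /inc_mul bilin_ext_e.
Qed.

Lemma inc_star_e C x y u v : (x < y)%O -> (u < v)%O ->
  inc_star C (inc_e x y) (inc_e u v) =
    if (y == u) && ((x, y, v) \in C) then inc_e x v else 0.
Proof.
move=> xy uv; pose p : interval := exist _ (x, y) (ltW xy).
pose q : interval := exist _ (u, v) (ltW uv).
rewrite [LHS](_ : _ = inc_star C (inc_e (val p).1 (val p).2)
  (inc_e (val q).1 (val q).2)) //.
by rewrite /inc_star bilin_ext_e /= xy uv.
Qed.

Lemma inc_e_radical x y : (x < y)%O -> inc_e x y \in radical.
Proof.
by move=> xy; apply: memv_span; apply/imageP; exists (x, y).
Qed.

Lemma radicalP (a : incidence) :
  reflect (forall p : interval, (val p).1 = (val p).2 -> a p = 0)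
          (a \in radical).
Proof.
apply: (iffP idP) => [/coord_span -> p pd | a0].
  rewrite sum_ffunE big1 // => i _; rewrite ffunE.
  set s := image_tuple _ _; have : s`_i \in s by rewrite mem_nth ?size_tuple.
  case/imageP => -[x y] /= xy ->; rewrite inc_eE.
  case: eqP => [pxy|]; last by rewrite scaler0.
  by move: xy pd; rewrite pxy /= inE /= => /[swap] ->; rewrite ltxx.
rewrite (inc_decomp a); apply: memv_suml => p _.
have [/a0 ->|/eqP np] := eqVneq (val p).1 (val p).2.
  by rewrite scale0r mem0v.
by apply/memvZ/inc_e_radical; rewrite lt_neqAle (valP p) andbT; apply/eqP.
Qed.

Lemma inc_ind (P : incidence -> Prop) :
  P 0 -> (forall k a b, P a -> P b -> P (k *: a + b)) ->
  (forall x y, (x <= y)%O -> P (inc_e x y)) -> forall a, P a.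
Proof.
move=> P0 PD Pe a; rewrite (inc_decomp a).
elim/big_ind: _ => // [u v Pu Pv | p _].
  by rewrite -[u]scale1r; apply: PD.
by rewrite -[_ *: _]addr0; apply: PD => //; apply/Pe/(valP p).
Qed.

Lemma inc_mulPl k a b c : inc_mul (k *: a + b) c = k *: inc_mul a c + inc_mul b c.
Proof. exact: (bilin_ext_bilinear _).1. Qed.

Lemma inc_mulPr k a b c : inc_mul c (k *: a + b) = k *: inc_mul c a + inc_mul c b.
Proof. exact: (bilin_ext_bilinear _).2. Qed.

Lemma inc_mulA : associative inc_mul.
Proof.
move=> a b c; elim/inc_ind: a => [|k a a' Ha Ha'|x y xy].
- by rewrite !linear0l.
- by rewrite !inc_mulPl Ha Ha'.
elim/inc_ind: b => [|k b b' Hb Hb'|z t zt].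
- by rewrite !(linear0l, linear0r).
- by rewrite !(inc_mulPl, inc_mulPr) Hb Hb'.
elim/inc_ind: c => [|k c c' Hc Hc'|u v uv].
- by rewrite !linear0r.
- by rewrite !inc_mulPr Hc Hc'.
rewrite !inc_mul_e // linearZr_LR linearZl_LR /=.
case: (eqVneq y z) (zt) => [<- yt|yz _]; last first.
  rewrite scale0r; have [tu|_] := eqVneq t u; last by rewrite scale0r.
  by rewrite inc_mul_e ?(negPf yz) ?scale0r ?scaler0 // (le_trans zt) ?tu.
rewrite scale1r; case: (eqVneq t u) (uv) => [<- tv|tu _].
  have xt := le_trans xy yt; have yv := le_trans yt tv.
  by rewrite !scale1r !inc_mul_e // !eqxx.
by rewrite scale0r inc_mul_e ?(negPf tu) ?scale0r // (le_trans xy).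
Qed.

Lemma inc_1mul : left_id inc_one inc_mul.
Proof.
elim/inc_ind => [|k a b Ha Hb|x y xy]; first by rewrite linear0r.
  by rewrite inc_mulPr Ha Hb.
rewrite /inc_one linear_sumlz (bigD1 x) //= inc_mul_e // eqxx scale1r.
by rewrite big1 ?addr0 // => z zx; rewrite inc_mul_e // (negPf zx) scale0r.
Qed.

Lemma inc_mul1 : right_id inc_one inc_mul.
Proof.
elim/inc_ind => [|k a b Ha Hb|x y xy]; first by rewrite linear0l.
  by rewrite inc_mulPl Ha Hb.
rewrite /inc_one linear_sumr (bigD1 y) //= inc_mul_e // eqxx scale1r.
by rewrite big1 ?addr0 // => z zy; rewrite inc_mul_e // eq_sym (negPf zy) scale0r.
Qed.

Lemma inc_mulE a b (r : interval) :
  inc_mul a b r = \sum_(p : interval) \sum_(q : interval |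
    ((val p).2 == (val q).1) && (val r == ((val p).1, (val q).2))) a p * b q.
Proof.
rewrite sum_ffunE; apply: eq_bigr => p _; rewrite sum_ffunE [RHS]big_mkcond.
apply: eq_bigr => q _ /=; rewrite !ffunE /GRing.scale /=.
by do 2!case: (_ == _) => /=; rewrite !(mulr1, mulr0, mul0r).
Qed.

Lemma inc_mul_diag a b (r : interval) :
  (val r).1 = (val r).2 -> inc_mul a b r = a r * b r.
Proof.
move=> dr; rewrite inc_mulE (bigD1 r) //= (bigD1 r) /=; last first.
  by rewrite -surjective_pairing eqxx andbT -dr eqxx.
have H (p q : interval) : (val p).2 == (val q).1 ->
    val r == ((val p).1, (val q).2) -> p = r /\ q = r.
  case: p q r dr => [[x y] /= xy] [[z t] /= zt] [[u v] /= uv] /= duv.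
  move=> /eqP yz /eqP[ux vt]; subst.
  have E : z = t by apply/le_anti; rewrite zt.
  by subst; split; apply: val_inj.
rewrite !big1 ?addr0 // => [p np|q /andP[/andP[h1 h2] nq]].
  rewrite big1 // => q /andP[h1 h2]; have [pr _] := H _ _ h1 h2.
  by rewrite pr eqxx in np.
by have [_ qr] := H _ _ h1 h2; rewrite qr eqxx in nq.
Qed.

Lemma inc_one_diag (r : interval) : (val r).1 = (val r).2 -> inc_one r = 1.
Proof.
case: r => [[x y] xy] /= dxy; subst y.
rewrite sum_ffunE (bigD1 x) //= big1 ?addr0 ?inc_eE ?eqxx // => z zx.
by rewrite inc_eE /= xpair_eqE eq_sym (negPf zx).
Qed.

Lemma radical_quasireg n : n \in radical ->
  exists c, inc_mul c (inc_one - n) = inc_one.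
Proof.
move=> /radicalP n0.
have lin : linear (inc_mul^~ (inc_one - n)) by move=> k a b; rewrite inc_mulPl.
pose f0 : {linear incidence -> incidence} :=
  HB.pack (inc_mul^~ (inc_one - n)) (GRing.isLinear.Build _ _ _ _ _ lin).
pose f := linfun f0.
have fE c : f c = inc_mul c (inc_one - n) by rewrite lfunE.
have kf : lker f == 0%VS.
  apply/lker0P => a b /eqP; rewrite -subr_eq0 -linearB /= => /eqP fab.
  apply/eqP; rewrite -subr_eq0; apply/eqP; move: (a - b) fab => c.
  rewrite fE linearBr /= inc_mul1 => /eqP; rewrite subr_eq0 => /eqP cn.
  apply/ffunP => r; rewrite ffunE.
  have [m] := ubnP #|[set z | (z <= (val r).2)%O]|.
  elim: m r => // m IH r rm; rewrite cn inc_mulE.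
  rewrite big1 // => p _; rewrite big1 // => q /andP[/eqP pq /eqP rpq].
  have [/n0->|nq] := eqVneq (val q).1 (val q).2; first by rewrite mulr0.
  rewrite IH ?mul0r //; move: rm; rewrite ltnS; apply: leq_trans.
  rewrite rpq /= pq.
  have lq : ((val q).1 < (val q).2)%O by rewrite lt_neqAle nq (valP q).
  apply/proper_card/properP; split.
    by apply/subsetP => z; rewrite !inE => /le_trans; apply; exact: ltW.
  by exists (val q).2; rewrite !inE ?lexx // lt_geF.
exists ((f^-1)%VF inc_one); rewrite -fE; apply: limg_lfunVK.
have -> : limg f = fullv; last exact: memvf.
apply/eqP; rewrite eqEdim subvf /= limg_dim_eq ?leqnn //.
by rewrite (eqP kf) capv0.
Qed.

(* [radical], defined as the span of the e_xy with x < y, is the Jacobson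
   radical of the incidence algebra: the set of those a such that 1 - b a is
   left invertible for every b. *)
Lemma radical_jacobson a : a \in radical <->
  (forall b, exists c, inc_mul c (inc_one - inc_mul b a) = inc_one).
Proof.
split=> [/radicalP a0 b|qr].
  apply: radical_quasireg; apply/radicalP => p dp.
  by rewrite inc_mul_diag // a0 // mulr0.
apply/radicalP => r dr; apply/eqP; apply: contraT => ar.
have [c /(congr1 (fun z : incidence => z r))] :=
  qr ((a r)^-1 *: inc_e (val r).1 (val r).2).
rewrite inc_mul_diag // [X in _ * X]ffunE [X in _ + X]ffunE.
rewrite inc_mul_diag // inc_one_diag // ffunE inc_e_val eqxx.
rewrite /GRing.scale /= mulr1 mulVf // subrr mulr0 => /eqP.
by rewrite eq_sym oner_eq0.
Qed.

Lemma inc_mul_radical (a b : incidence) :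
  a \in radical -> b \in radical -> inc_mul a b \in radical.
Proof.
move=> /radicalP a0 _; apply: memv_suml => p _; apply: memv_suml => q _.
have [/a0 ->|np] := eqVneq (val p).1 (val p).2.
  by rewrite mul0r scale0r mem0v.
apply: memvZ; case: eqP => [pq|_]; last by rewrite scale0r mem0v.
apply/memvZ/inc_e_radical; apply: lt_le_trans (valP q); rewrite -pq.
by rewrite lt_neqAle np (valP p).
Qed.

Lemma inc_star_radical C (a b : incidence) : inc_star C a b \in radical.
Proof.
apply: memv_suml => p _; apply: memv_suml => q _; apply: memvZ.
case: ifP => [/and4P[pl ql /eqP pq _]|_]; last exact: mem0v.
by apply/inc_e_radical/(lt_trans pl); rewrite pq.
Qed.

Definition J_mul (a b : J) : J :=
  Subvs (inc_mul_radical (subvsP a) (subvsP b)).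

Definition J_star (C : {set X * X * X}) (a b : J) : J :=
  Subvs (inc_star_radical C (vsval a) (vsval b)).

Lemma J_mul_bilinear : bilinear_for *:%R *:%R J_mul.
Proof.
split=> [b k a a' | a k b b']; apply/val_inj => /=.
  exact: ((bilin_ext_bilinear _).1 (vsval b)).
exact: ((bilin_ext_bilinear _).2 (vsval a)).
Qed.

Lemma J_star_bilinear C : bilinear_for *:%R *:%R (J_star C).
Proof.
split=> [b k a a' | a k b b']; apply/val_inj => /=.
  exact: ((bilin_ext_bilinear _).1 (vsval b)).
exact: ((bilin_ext_bilinear _).2 (vsval a)).
Qed.

HB.instance Definition _ :=
  bilinear_isBilinear.Build K J J J *:%R *:%R J_mul J_mul_bilinear.
HB.instance Definition _ C :=
  bilinear_isBilinear.Build K J J J *:%R *:%R (J_star C) (J_star_bilinear C).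

Lemma chained_sym : symmetric chained.
Proof.
move=> s t; rewrite /chained andbCA; do 2!congr (_ && _).
apply: eq_existsb => c; congr (_ && _).
rewrite (all_cat _ [:: _; _; _] [:: _; _; _]) andbC.
by rewrite -(all_cat _ [:: _; _; _] [:: _; _; _]).
Qed.

Lemma approx_equiv : equivalence_rel approx.
Proof.
have sC : connect_sym chained by apply: sym_connect_sym; exact: chained_sym.
by apply/equivalence_relP; split=> [s|s t st]; [exact: connect0|];
  move=> u; apply/(same_connect sC).
Qed.

Lemma triple_classes_partition : partition triple_classes triples.
Proof.
by apply: equivalence_partitionP => s t u _ _ _; exact: approx_equiv.
Qed.

End Incidence.

(* Main.v *)
(** In coordinates, the product [a . b] is the matrix product, and
    [\sum_C alpha_C *_C] is the matrix product whose term of index [z] in the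
    entry (x, y) is weighted by [alpha_C], with [C] the class of (x, z, y).  Since
    the four triples of a 4-chain x < y < z < w are chained, all the ways of
    nesting two weighted products with weights constant on the classes agree,
    so such a weighted product is totally compatible with the product.
    Conversely, if [*] is totally compatible, then the weight s(x, y, z), the
    entry (x, z) of [e_xy * e_yz], takes the same value on the four triples of
    a 4-chain, hence is constant on the classes.  Comparing [e_xy . (e_yz * c)] and
    [(e_xy * e_yz) . c] shows that [*] agrees with the product of weight s on
    [J.J x J], and total compatibility forces their difference to be
    annihilator-valued. *)
Require Import Defs.
From HB Require Import structures.
From mathcomp Require Import all_boot all_order all_algebra sesquilinear.

Set Implicit Arguments.
Unset Strict Implicit.
Unset Printing Implicit Defensive.

Import Order.TTheory GRing.Theory.
Local Open Scope ring_scope.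

(** * Annihilator-valued products as four identities *)

Section AnnihilatorValued.
Variables (K : fieldType) (V : lmodType K).
Implicit Types (mul bul : {bilinear V -> V -> V}).

Lemma zero_span (S : V -> Prop) :
  is_zero_space (lin_span S) <-> forall v, S v -> v = 0.
Proof.
split=> [S0 v Sv | S0 v].
  by apply/S0; exists 1%N, (fun=> 1), (fun=> v); rewrite big_ord1 scale1r.
split=> [[n [k [u [Su ->]]]] | ->].
  by rewrite big1 // => i _; rewrite (S0 _ (Su i)) scaler0.
by exists 0%N, (fun=> 0), (fun=> 0); split=> [[]|]; rewrite ?big_ord0.
Qed.

Lemma prod_spanP (op : V -> V -> V) a b : prod_span op (@whole K V) (@whole K V) (op a b).
Proof.
exists 1%N, (fun=> 1), (fun=> op a b); split=> [_|]; last first.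
  by rewrite big_ord1 scale1r.
by exists a, b.
Qed.

(** By bilinearity each nested span is zero once its generating products are; [zl] and [zr] treat
    the two ways of nesting. *)
Lemma annihilator_valuedP mul bul :
  annihilator_valued mul bul <->
  [/\ forall a b c, bul (mul a b) c = 0, forall a b c, mul (bul a b) c = 0,
      forall a b c, mul a (bul b c) = 0 & forall a b c, bul a (mul b c) = 0].
Proof.
have zl (f g : {bilinear V -> V -> V}) :
    is_zero_space (prod_span f (prod_span g (@whole K V) (@whole K V)) (@whole K V))
    <-> forall a b c, f (g a b) c = 0.
  split=> [/zero_span z a b c | z].
    by apply: z; exists (g a b), c; split=> //; exact: prod_spanP.
  apply/zero_span => v [_ [c [[n [k [u [Su ->]]]] _ ->]]].
  rewrite linear_sumlz big1 // => i _.
  by have [a [b [_ _ ->]]] := Su i; rewrite linearZl_LR z /= scaler0.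
have zr (f g : {bilinear V -> V -> V}) :
    is_zero_space (prod_span f (@whole K V) (prod_span g (@whole K V) (@whole K V)))
    <-> forall a b c, f a (g b c) = 0.
  split=> [/zero_span z a b c | z].
    by apply: z; exists a, (g b c); split=> //; exact: prod_spanP.
  apply/zero_span => v [c [_ [_ [n [k [u [Su ->]]]] ->]]].
  rewrite linear_sumr big1 // => i _.
  by have [a [b [_ _ ->]]] := Su i; rewrite linearZr_LR z /= scaler0.
by split=> -[/zl ? /zl ? /zr ? /zr ?]; split=> //; first [exact/zl | exact/zr].
Qed.

End AnnihilatorValued.

(** * Matrix coordinates on the radical *)

Section Coordinates.
Variables (K : fieldType) (d : Order.disp_t) (X : finPOrderType d).
Local Notation J := (J K X).

(** The default 0 off the order lets the sums of matrix products run over all of [X]. *)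
Definition coef (a : J) (x y : X) : K :=
  if insub (x, y) is Some p then (vsval a : incidence K X) p else 0.

(** The projection makes this total; it is the basis vector e_xy only when x < y. *)
Definition Je (x y : X) : J := vsproj (radical K X) (inc_e K x y).

Lemma val_Je x y : (x < y)%O -> vsval (Je x y) = inc_e K x y.
Proof. by move=> xy; rewrite vsprojK // inc_e_radical. Qed.

Lemma coef_lt a x y : ~~ (x < y)%O -> coef a x y = 0.
Proof.
rewrite /coef; case: insubP => [p pxy vp|//]; rewrite lt_neqAle pxy andbT negbK.
by move=> /eqP xy; apply: (radicalP _ (valP a)); rewrite vp.
Qed.

Lemma coef_inj a b : (forall x y, coef a x y = coef b x y) -> a = b.
Proof.
move=> ab; apply/val_inj/ffunP => p; have := ab (val p).1 (val p).2.
by rewrite /coef -surjective_pairing valK.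
Qed.

Lemma coefP k a b x y : coef (k *: a + b) x y = k * coef a x y + coef b x y.
Proof.
by rewrite /coef; case: insubP => [p _ _|_]; rewrite ?mulr0 ?addr0 // !ffunE.
Qed.

Lemma coef0 x y : coef 0 x y = 0.
Proof. by rewrite /coef; case: insubP => [p _ _|//]; rewrite ffunE. Qed.

Lemma coefD a b x y : coef (a + b) x y = coef a x y + coef b x y.
Proof. by rewrite -[a]scale1r coefP mul1r scale1r. Qed.

Lemma coefZ k a x y : coef (k *: a) x y = k * coef a x y.
Proof. by rewrite -[k *: a]addr0 coefP coef0 addr0. Qed.

Lemma coef_sum (I : Type) (r : seq I) (P : pred I) (F : I -> J) x y :
  coef (\sum_(i <- r | P i) F i) x y = \sum_(i <- r | P i) coef (F i) x y.
Proof. exact: (big_morph (fun a => coef a x y) (fun a b => coefD a b x y) (coef0 x y)). Qed.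

Lemma coef_Je u v x y : (u < v)%O -> coef (Je u v) x y = ((x == u) && (y == v))%:R.
Proof.
move=> uv; rewrite /coef val_Je //; case: insubP => [p _ vp|].
  by rewrite inc_eE vp xpair_eqE.
by case: eqP => [->|//]; case: eqP => [->|//] /=; rewrite (ltW uv).
Qed.

Lemma J_ind (P : J -> Prop) :
  P 0 -> (forall k a b, P a -> P b -> P (k *: a + b)) ->
  (forall x y, (x < y)%O -> P (Je x y)) -> forall a, P a.
Proof.
move=> P0 PD Pe a.
have -> : a = \sum_(p : X * X) coef a p.1 p.2 *: Je p.1 p.2.
  apply: coef_inj => x y; rewrite coef_sum (bigD1 (x, y)) //= big1 => [|[u v] uv].
    have [xy|nxy] := boolP (x < y)%O; last by rewrite (coef_lt a nxy) coefZ mul0r addr0.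
    by rewrite coefZ coef_Je // !eqxx mulr1 addr0.
  rewrite coefZ /=; have [luv|nuv] := boolP (u < v)%O; last by rewrite coef_lt ?mul0r.
  by rewrite coef_Je // -xpair_eqE eq_sym (negPf uv) mulr0.
elim/big_ind: _ => // [b c Pb Pc | [x y] _ /=].
  by rewrite -[b]scale1r; apply: PD.
have [xy|nxy] := boolP (x < y)%O; last by rewrite coef_lt // scale0r.
by rewrite -[_ *: _]addr0; apply: PD => //; apply: Pe.
Qed.

(** Both sides are bilinear in [a] and [b], and on basis vectors e_xy and e_uv only the index z = y
    can contribute. *)
Lemma coef_weighted (op : {bilinear J -> J -> J}) (w : X -> X -> X -> K) :
  (forall x y u v, (x < y)%O -> (u < v)%O ->
     op (Je x y) (Je u v) = ((y == u)%:R * w x y v) *: Je x v) ->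
  forall a b x y, coef (op a b) x y = \sum_z w x z y * (coef a x z * coef b z y).
Proof.
move=> ope a b p q; elim/J_ind: a => [|k a a' Ha Ha'|x y xy].
- by rewrite linear0l coef0 big1 // => z _; rewrite coef0 mul0r mulr0.
- rewrite linearPl /= coefP Ha Ha' mulr_sumr -big_split /=.
  by apply: eq_bigr => z _; rewrite coefP mulrDl mulrDr -mulrA [k * (w _ _ _ * _)]mulrCA.
elim/J_ind: b => [|k b b' Hb Hb'|u v uv].
- by rewrite linear0r coef0 big1 // => z _; rewrite coef0 !mulr0.
- rewrite linearPr /= coefP Hb Hb' mulr_sumr -big_split /=.
  apply: eq_bigr => z _; rewrite coefP !mulrDr; congr (_ + _).
  by rewrite [coef _ _ _ * (k * _)]mulrCA [w _ _ _ * (k * _)]mulrCA.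
rewrite ope // (bigD1 y) //= big1 ?addr0 => [|z zy]; last first.
  by rewrite coef_Je // (negPf zy) andbF mul0r mulr0.
rewrite coefZ (coef_Je _ _ xy) (coef_Je _ _ uv) eqxx andbT.
have [yu|] := eqVneq y u; last by rewrite !mul0r !mulr0.
have xv : (x < v)%O by rewrite (lt_trans xy) // yu.
rewrite coef_Je // mul1r; case: eqP => [->|_]; last by rewrite mul0r !mulr0.
by rewrite /= mul1r; case: eqP => [->|_] //; rewrite !mulr0.
Qed.

Lemma J_mul_e x y u v : (x < y)%O -> (u < v)%O ->
  J_mul (Je x y) (Je u v) = (y == u)%:R *: Je x v.
Proof.
move=> xy uv; apply/val_inj; rewrite /= (val_Je xy) (val_Je uv) inc_mul_e ?ltW //.
have [yu|] := eqVneq y u; last by rewrite !scale0r.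
by rewrite !scale1r val_Je // (lt_trans xy) ?yu.
Qed.

Lemma J_star_e C x y u v : (x < y)%O -> (u < v)%O ->
  J_star C (Je x y) (Je u v) = ((y == u)%:R * ((x, y, v) \in C)%:R) *: Je x v.
Proof.
move=> xy uv; apply/val_inj; rewrite /= (val_Je xy) (val_Je uv) inc_star_e //.
have [yu|] := eqVneq y u; last by rewrite /= mul0r !scale0r.
rewrite mul1r /=; case: (_ \in C); last by rewrite !scale0r.
by rewrite !scale1r val_Je // (lt_trans xy) ?yu.
Qed.

Lemma coef_mul a b x y : coef (J_mul a b) x y = \sum_z coef a x z * coef b z y.
Proof.
rewrite (@coef_weighted _ (fun _ _ _ => 1)) => [|*]; last first.
  by rewrite /= J_mul_e // mulr1.
by apply: eq_bigr => z _; rewrite mul1r.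
Qed.

End Coordinates.

(** * Functions constant on the triples of each 4-chain *)

Section ChainConstant.
Variables (d : Order.disp_t) (X : finPOrderType d) (T : Type).

Definition constant_on_4chains (f : X -> X -> X -> T) :=
  forall x y z w, (x < y)%O -> (y < z)%O -> (z < w)%O ->
    [/\ f x z w = f x y z, f y z w = f x y z & f x y w = f x y z].

Lemma chained_4chain (x y z w : X) : (x < y)%O -> (y < z)%O -> (z < w)%O ->
  [/\ chained (x, z, w) (x, y, z), chained (y, z, w) (x, y, z)
    & chained (x, y, w) (x, y, z)].
Proof.
move=> xy yz zw; have [xz yw] := (lt_trans xy yz, lt_trans yz zw).
have xw := lt_trans xz zw.
suff ch : is_chain [set x; y; z; w].
  by split; rewrite /chained !inE /= ?(xy, yz, zw, xz, yw, xw);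
    apply/existsP; exists [set x; y; z; w]; rewrite ch !inE !eqxx ?orbT.
apply/andP; split; first by apply/set0Pn; exists x; rewrite !inE eqxx.
apply/forall_inP => u; rewrite !inE => us; apply/forall_inP => v; rewrite !inE => vs.
move: us vs; rewrite /Order.comparable.
do ![case/orP] => /eqP-> => vs; move: vs;
  do ![case/orP] => /eqP->; rewrite ?lexx ?(ltW xy) ?(ltW yz) ?(ltW zw) ?(ltW xz)
    ?(ltW yw) ?(ltW xw) ?orbT //.
Qed.

Lemma constant_on_chained (f : X -> X -> X -> T) s t :
  constant_on_4chains f -> chained s t ->
  f s.1.1 s.1.2 s.2 = f t.1.1 t.1.2 t.2.
Proof.
case: s t => [[x y] z] [[u v] w] f4 /and3P[]; rewrite !inE /=.
move=> /andP[xy yz] /andP[uv vw] /existsP[c /andP[/andP[_ /forall_inP cc]]].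
rewrite andbT => /and5P[cx cy cz cu /andP[cv cw]].
have cmp p q : p \in c -> q \in c -> (p >=< q)%O.
  by move=> pc qc; have /forall_inP := cc p pc; apply.
(* Lower the first entries to [m], raise the last ones to [M], and then compare
   the middle entries. *)
have lower x' x0 y0 z0 : x' \in c -> x0 \in c -> (x0 < y0)%O -> (y0 < z0)%O ->
    f x0 y0 z0 = f (Order.min x' x0) y0 z0.
  move=> cx' cx0 l1 l2; case: (comparable_leP (cmp _ _ cx' cx0)) => //.
  rewrite le_eqVlt => /predU1P[->//|l0].
  by have [_ -> <-] := f4 _ _ _ _ l0 l1 l2; have [-> _ ->] := f4 _ _ _ _ l0 l1 l2.
have raise z' x0 y0 z0 : z' \in c -> z0 \in c -> (x0 < y0)%O -> (y0 < z0)%O ->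
    f x0 y0 z0 = f x0 y0 (Order.max z0 z').
  move=> cz' cz0 l1 l2; case: (comparable_leP (cmp _ _ cz0 cz')) => //.
  rewrite le_eqVlt => /predU1P[->//|l3].
  by have [_ _ ->] := f4 _ _ _ _ l1 l2 l3.
have lt_min p q r : p \in c -> q \in c -> (q < r)%O -> (Order.min p q < r)%O.
  move=> cp cq qr; case: (comparable_leP (cmp _ _ cp cq)) => // pq.
  exact: le_lt_trans qr.
have lt_max p q r : p \in c -> q \in c -> (r < q)%O -> (r < Order.max q p)%O.
  move=> cp cq rq; case: (comparable_leP (cmp _ _ cq cp)) => // pq.
  exact: lt_le_trans pq.
rewrite (lower u x) // (lower x u) // (raise w) // ?lt_min //.
rewrite [RHS](raise z) // ?lt_min //.
rewrite (comparable_minC (cmp _ _ cu cx)) (comparable_maxC (cmp _ _ cz cw)).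
have my := lt_min u x y cu cx xy; rewrite (comparable_minC (cmp _ _ cu cx)) in my.
have yM := lt_max w z y cw cz yz; rewrite (comparable_maxC (cmp _ _ cz cw)) in yM.
have mv := lt_min x u v cx cu uv; have vM := lt_max z w v cz cw vw.
case: (comparable_ltgtP (cmp _ _ cy cv)) => [yv|vy|->//].
  by have [-> _ ->] := f4 _ _ _ _ my yv vM.
by have [-> _ ->] := f4 _ _ _ _ mv vy yM.
Qed.

End ChainConstant.

(** * Class sums as weighted matrix products *)

Section ClassSum.
Variables (K : fieldType) (d : Order.disp_t) (X : finPOrderType d).
Local Notation J := (J K X).
Local Notation mul := (@J_mul K d X).
Implicit Types (alpha : {set X * X * X} -> K) (f : X -> X -> X -> K).

Definition class_sum alpha (a b : J) : J :=
  \sum_(C in triple_classes X) alpha C *: J_star C a b.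

Lemma class_sum_bilinear alpha : bilinear_for *:%R *:%R (class_sum alpha).
Proof.
split=> [b k a a' | a k b b'] /=; rewrite /class_sum scaler_sumr -big_split;
  apply: eq_bigr => C _ /=.
  by rewrite linearPl scalerDr !scalerA [k * _]mulrC.
by rewrite linearPr scalerDr !scalerA [k * _]mulrC.
Qed.

HB.instance Definition _ alpha :=
  bilinear_isBilinear.Build K J J J *:%R *:%R (class_sum alpha)
    (class_sum_bilinear alpha).

(** As the classes partition [triples X], this is [alpha] at the class of (x, y, z) when x < y < z,
    and 0 otherwise. *)
Definition weight alpha (x y z : X) : K :=
  \sum_(C in triple_classes X) alpha C * ((x, y, z) \in C)%:R.

Lemma class_sum_e alpha x y u v : (x < y)%O -> (u < v)%O ->
  class_sum alpha (Je K x y) (Je K u v) = ((y == u)%:R * weight alpha x y v) *: Je K x v.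
Proof.
move=> xy uv; rewrite /class_sum /weight mulr_sumr scaler_suml.
by apply: eq_bigr => C _; rewrite J_star_e // scalerA mulrCA.
Qed.

Definition weighted f (op : J -> J -> J) :=
  forall a b x y, coef (op a b) x y = \sum_z f x z y * (coef a x z * coef b z y).

Lemma weighted_mul : weighted (fun _ _ _ => 1) mul.
Proof.
by move=> a b x y; rewrite coef_mul; apply: eq_bigr => z _; rewrite mul1r.
Qed.

Lemma weighted_class_sum alpha : weighted (weight alpha) (class_sum alpha).
Proof. by move=> *; apply: coef_weighted => *; exact: class_sum_e. Qed.

(** The entry (x, w) of either side is a double sum over y and z of weighted terms a_xy b_yz c_zw.
    Such a term vanishes unless x < y < z < w, so the weights need to be compared on 4-chains
    only. *)
Lemma weighted_nest f1 f2 f3 f4 (op1 op2 op3 op4 : J -> J -> J) :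
  weighted f1 op1 -> weighted f2 op2 -> weighted f3 op3 -> weighted f4 op4 ->
  (forall x y z w, (x < y)%O -> (y < z)%O -> (z < w)%O ->
     f1 x z w * f2 x y z = f3 x y w * f4 y z w) ->
  forall a b c, op1 (op2 a b) c = op3 a (op4 b c).
Proof.
move=> w1 w2 w3 w4 f1234 a b c; apply: coef_inj => x w; rewrite w1 w3.
transitivity (\sum_z \sum_y
    f1 x z w * f2 x y z * (coef a x y * coef b y z * coef c z w)).
  apply: eq_bigr => z _; rewrite w2 mulr_suml mulr_sumr.
  by apply: eq_bigr => y _; rewrite !mulrA.
rewrite exchange_big; apply: eq_bigr => y _ /=.
rewrite w4 !mulr_sumr; apply: eq_bigr => z _.
have [xy|/coef_lt->] := boolP (x < y)%O; last by rewrite !mul0r !mulr0.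
have [yz|/coef_lt->] := boolP (y < z)%O; last by rewrite !(mul0r, mulr0).
have [zw|/coef_lt->] := boolP (z < w)%O; last by rewrite !mulr0.
by rewrite f1234 // -!mulrA; congr (_ * _); rewrite mulrCA.
Qed.

Lemma weight_4chain alpha : constant_on_4chains (weight alpha).
Proof.
have approx_class s t C : C \in triple_classes X -> chained s t ->
    (s \in C) = (t \in C).
  have /and3P[_ triv _] := triple_classes_partition X.
  have imp u v : C \in triple_classes X -> chained u v -> u \in C -> v \in C.
    move=> CC cuv uC; have /and3P[ut vt _] := cuv.
    rewrite -(def_pblock triv CC uC) pblock_equivalence_partition //.
      exact: connect1.
    by move=> ? ? ? _ _ _; exact: approx_equiv.
  by move=> CC cst; apply/idP/idP; apply: imp => //; rewrite chained_sym.
move=> x y z w xy yz zw; have [c1 c2 c3] := chained_4chain xy yz zw.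
by split; apply: eq_bigr => C CC; congr (_ * _%:R); congr nat_of_bool;
  apply: approx_class.
Qed.

Lemma class_sumA alpha : associative (class_sum alpha).
Proof.
move=> a b c; apply/esym/weighted_nest; try exact: weighted_class_sum.
move=> x y z w xy yz zw.
by have [-> -> ->] := weight_4chain alpha xy yz zw.
Qed.

Lemma class_sum_tc alpha : totally_compatible mul (class_sum alpha).
Proof.
have wS := @weighted_class_sum alpha; have wm := weighted_mul.
have E1 : forall a b c, class_sum alpha (mul a b) c = mul a (class_sum alpha b c).
  apply: (weighted_nest wS wm wm wS) => x y z w xy yz zw.
  by have [-> -> _] := weight_4chain alpha xy yz zw; rewrite mulrC.
have E2 : forall a b c, mul (class_sum alpha a b) c = mul a (class_sum alpha b c).
  apply: (weighted_nest wm wS wm wS) => x y z w xy yz zw.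
  by have [_ -> _] := weight_4chain alpha xy yz zw.
have E3 : forall a b c, mul (class_sum alpha a b) c = class_sum alpha a (mul b c).
  apply: (weighted_nest wm wS wS wm) => x y z w xy yz zw.
  by have [_ _ ->] := weight_4chain alpha xy yz zw; rewrite mulrC.
by move=> a b c; split; rewrite ?E1 ?E2 // -E2 E3.
Qed.

Lemma coef_mul_Jer a u v x y : (u < v)%O ->
  coef (mul a (Je K u v)) x y = coef a x u * (y == v)%:R.
Proof.
move=> uv; rewrite coef_mul (bigD1 u) //= big1 => [|z zu].
  by rewrite coef_Je // eqxx addr0.
by rewrite coef_Je // (negPf zu) mulr0.
Qed.

Lemma coef_mul_Jel a u v x y : (u < v)%O ->
  coef (mul (Je K u v) a) x y = (x == u)%:R * coef a v y.
Proof.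
move=> uv; rewrite coef_mul (bigD1 v) //= big1 => [|z zv].
  by rewrite coef_Je // eqxx andbT addr0.
by rewrite coef_Je // (negPf zv) andbF mul0r.
Qed.

(** Multiplying [u] by e_zy on the right shows that column z of [u] vanishes as soon as z lies below
    some y, and no other column enters a weighted product. *)
Lemma class_sum_annl alpha u : (forall c, mul u c = 0) ->
  forall c, class_sum alpha u c = 0.
Proof.
move=> u0 c; apply: coef_inj => x y; rewrite weighted_class_sum coef0 big1 // => z _.
have [zy|/coef_lt->] := boolP (z < y)%O; last by rewrite !mulr0.
have := coef_mul_Jer u x y zy; rewrite u0 coef0 eqxx mulr1 => <-.
by rewrite mul0r mulr0.
Qed.

Lemma class_sum_annr alpha u : (forall c, mul c u = 0) ->
  forall c, class_sum alpha c u = 0.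
Proof.
move=> u0 c; apply: coef_inj => x y; rewrite weighted_class_sum coef0 big1 // => z _.
have [xz|/coef_lt->] := boolP (x < z)%O; last by rewrite mul0r mulr0.
have := coef_mul_Jel u x y xz; rewrite u0 coef0 eqxx mul1r => <-.
by rewrite !mulr0.
Qed.

(** On two basis vectors the class sum is a multiple of their product, so all its values lie in the
    span of J.J. *)
Lemma class_sum_ind alpha (P : J -> Prop) :
  P 0 -> (forall k a b, P a -> P b -> P (k *: a + b)) ->
  (forall a b, P (mul a b)) -> forall a b, P (class_sum alpha a b).
Proof.
move=> P0 PD Pm a b; elim/J_ind: a => [|k a a' Pa Pa'|x y xy].
- by rewrite linear0l.
- by rewrite linearPl; apply: PD.
elim/J_ind: b => [|k b b' Pb Pb'|u v uv].
- by rewrite linear0r.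
- by rewrite linearPr; apply: PD.
rewrite class_sum_e // mulrC -scalerA -J_mul_e // -[_ *: _]addr0.
exact: PD.
Qed.

(** The representative is arbitrary, which is harmless for [f] constant on 4-chains; the default 0
    is reached only by the empty set, which is not a class. *)
Definition class_value f (C : {set X * X * X}) : K :=
  if [pick t in C] is Some t then f t.1.1 t.1.2 t.2 else 0.

Lemma weight_class_value f x y z : constant_on_4chains f ->
  (x < y)%O -> (y < z)%O -> weight (class_value f) x y z = f x y z.
Proof.
move=> f4 xy yz; have tT : (x, y, z) \in triples X by rewrite inE /= xy.
have /and3P[/eqP cov triv _] := triple_classes_partition X.
have tc : (x, y, z) \in cover (triple_classes X) by rewrite cov.
rewrite /weight (bigD1 (pblock (triple_classes X) (x, y, z))) ?pblock_mem //=.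
rewrite mem_pblock tc mulr1 big1 ?addr0 => [|C /andP[CC nC]]; last first.
  case: (boolP (_ \in C)) => [tC|_]; last by rewrite mulr0.
  by rewrite (def_pblock triv CC tC) eqxx in nC.
rewrite /class_value; case: pickP => [t tB|/(_ (x, y, z))]; last first.
  by rewrite mem_pblock tc.
have tt : t \in triples X.
  by rewrite -cov; apply/bigcupP; exists (pblock (triple_classes X) (x, y, z));
    rewrite ?pblock_mem.
move: tB; rewrite pblock_equivalence_partition // => [|? ? ? _ _ _]; last first.
  exact: approx_equiv.
rewrite -[f x y z]/(f (x, y, z).1.1 (x, y, z).1.2 (x, y, z).2).
(* The representative [t] is joined to (x, y, z) by a path of chained triples, and [f] keeps its
   value at each step. *)
case/connectP=> p; elim: p (x, y, z) => [|s p IH] r /=; first by move=> _ ->.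
by move=> /andP[rs sp] lt; rewrite (IH s) // (constant_on_chained f4 rs).
Qed.

End ClassSum.

(** * The weight carried by a totally compatible product *)

Section Characterization.
Variables (K : fieldType) (d : Order.disp_t) (X : finPOrderType d).
Local Notation J := (J K X).
Local Notation mul := (@J_mul K d X).
Variable (star : {bilinear J -> J -> J}).

(** The product e_xy * e_yz may have other nonzero entries; these are left to the annihilator-valued
    part. *)
Definition star_coef (x y z : X) : K := coef (star (Je K x y) (Je K y z)) x z.

Hypothesis star_tc : totally_compatible mul star.

(** For e_xy, e_yz and e_zw, the entries (x, w) of the four nestings in total compatibility are the
    values of [star_coef] on the four triples of the chain. *)
Lemma star_coef_4chain : constant_on_4chains star_coef.
Proof.
move=> x y z w xy yz zw.
have [E1 E2 E3] := star_tc (Je K x y) (Je K y z) (Je K z w).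
pose co (u : J) := coef u x w.
move: (congr1 co E1) (congr1 co E2) (congr1 co E3).
rewrite /co !J_mul_e // !eqxx !scale1r !(coef_mul_Jer _ _ _ zw) !(coef_mul_Jel _ _ _ xy).
by rewrite !eqxx mulr1 mul1r /star_coef => -> <- <-.
Qed.

Lemma star_mull a b c :
  star (mul a b) c = class_sum (class_value star_coef) (mul a b) c.
Proof.
elim/J_ind: a => [|k a a' Ha Ha'|x y xy].
- by rewrite !linear0l.
- by rewrite [mul _ _]linearPl !linearPl Ha Ha'.
elim/J_ind: b => [|k b b' Hb Hb'|y' z yz].
- by rewrite linear0r !linear0l.
- by rewrite [mul _ _]linearPr !linearPl Hb Hb'.
rewrite J_mul_e //; case: (eqVneq y y') yz => [<-|_] yz; last first.
  by rewrite scale0r !linear0l.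
rewrite scale1r; have xz := lt_trans xy yz.
elim/J_ind: c => [|k c c' Hc Hc'|u w uw].
- by rewrite !linear0r.
- by rewrite !linearPr Hc Hc'.
have [E1 E2 E3] := star_tc (Je K x y) (Je K y z) (Je K u w).
(* Each equation now has e_xz * e_uw on its left. If z differs from u, then e_yz . e_uw = 0 and the
   third one makes it vanish. *)
have {E1 E2 E3} [E1 E2 E3] := And3 E1 (etrans E1 E2) (etrans E1 (etrans E2 E3)).
move: E1 E2 E3; rewrite !J_mul_e // eqxx scale1r class_sum_e //.
case: (eqVneq z u) uw => [<- zw E1 E2 _|_ _ _ _]; last first.
  by rewrite scale0r linear0r mul0r scale0r.
rewrite mul1r weight_class_value //; last exact: star_coef_4chain.
(* By [E2] only row x of e_xz * e_zw can be nonzero, and by [E1] only column w; the remaining entry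
   is [star_coef] by definition. *)
apply: coef_inj => p q; rewrite coefZ coef_Je ?(lt_trans xz) //.
have [->|pNx] := eqVneq p x; last by rewrite E2 coef_mul_Jel // (negPf pNx) mul0r mulr0.
have [->|qNw] := eqVneq q w; last by rewrite E1 coef_mul_Jer // (negPf qNw) !mulr0.
by rewrite mulr1.
Qed.

End Characterization.

(** * Adding a class sum to a product *)

Section Decomposition.
Variables (K : fieldType) (d : Order.disp_t) (X : finPOrderType d).
Local Notation J := (J K X).
Local Notation mul := (@J_mul K d X).

Definition star_sub (alpha : {set X * X * X} -> K) (star : {bilinear J -> J -> J})
  (a b : J) : J := star a b - class_sum alpha a b.

Lemma star_sub_bilinear alpha star : bilinear_for *:%R *:%R (star_sub alpha star).
Proof.
split=> [b k a a' | a k b b'] /=; rewrite /star_sub.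
  by rewrite !linearPl opprD addrACA -scalerBr.
by rewrite !linearPr opprD addrACA -scalerBr.
Qed.

HB.instance Definition _ alpha star :=
  bilinear_isBilinear.Build K J J J *:%R *:%R (star_sub alpha star)
    (star_sub_bilinear alpha star).

Variables (alpha : {set X * X * X} -> K) (star bul : {bilinear J -> J -> J}).
Hypothesis starE : forall a b, star a b = bul a b + class_sum alpha a b.
Local Notation S := (class_sum alpha).

(** The identities are additive in the second product, and the class sum satisfies them, so its
    terms cancel. *)
Lemma add_class_sum_tc : totally_compatible mul star <-> totally_compatible mul bul.
Proof.
have mulDl u v c : mul (u + v) c = mul u c + mul v c by exact: linearDl.
have mulDr u v c : mul c (u + v) = mul c u + mul c v by exact: linearDr.
split=> H a b c; have [E1 E2 E3] := H a b c;
  have [S1 S2 S3] := class_sum_tc alpha a b c.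
  move: E1 E2 E3; rewrite !starE mulDl mulDr S1 S2 S3.
  by move=> /addIr E1 /addIr E2 /addIr E3; split.
by rewrite !starE mulDl mulDr S1 S2 S3 E1 E2 E3.
Qed.

Hypothesis bul_ann : annihilator_valued mul bul.

(** The mixed terms vanish: [bul] kills the values of the class sum, which lie in the span of J.J,
    and the class sum kills the values of [bul], which [mul] annihilates on both sides. What remains
    besides [bul] is the associative class sum. *)
Lemma add_class_sumA : associative star <-> associative bul.
Proof.
have /annihilator_valuedP[bl lb rb br] := bul_ann.
have bSl a b c : bul (S a b) c = 0.
  apply: (@class_sum_ind _ _ _ _ (fun v => bul v c = 0)); first exact: linear0l.
    by move=> k u v u0 v0; rewrite linearPl u0 v0 scaler0 addr0.
  by move=> u v; exact: bl.
have bSr a b c : bul a (S b c) = 0.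
  apply: (@class_sum_ind _ _ _ _ (fun v => bul a v = 0)); first exact: linear0r.
    by move=> k u v u0 v0; rewrite linearPr u0 v0 scaler0 addr0.
  by move=> u v; exact: br.
have Sbl a b c : S (bul a b) c = 0 by apply: class_sum_annl => ?; exact: lb.
have Sbr a b c : S a (bul b c) = 0 by apply: class_sum_annr => ?; exact: rb.
have SDl u v c : S (u + v) c = S u c + S v c by exact: linearDl.
have SDr u v c : S c (u + v) = S c u + S c v by exact: linearDr.
have starl a b c : star (star a b) c = bul (bul a b) c + S (S a b) c.
  by rewrite !starE linearDl bSl addr0 SDl Sbl add0r.
have starr a b c : star a (star b c) = bul a (bul b c) + S a (S b c).
  by rewrite !starE linearDr bSr addr0 SDr Sbr add0r.
split=> H a b c; last by rewrite starl starr H class_sumA.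
by have := H a b c; rewrite starl starr class_sumA => /addIr.
Qed.

End Decomposition.

Theorem theorem5p12 (d : Order.disp_t) (X : finPOrderType d) (K : fieldType)
    (star : {bilinear J K X -> J K X -> J K X}) :
  tc_structure (@J_mul K d X) star <->
  exists (bul : {bilinear J K X -> J K X -> J K X})
         (alpha : {set X * X * X} -> K),
    annihilator_valued_structure (@J_mul K d X) bul /\
    forall a b : J K X,
      star a b = bul a b + \sum_(C in triple_classes X) alpha C *: J_star C a b.
Proof.
split=> [[starA star_tc] | [bul [alpha [[bulA bul_ann] starE]]]]; last first.
  split; first exact/(add_class_sumA starE bul_ann).
  have /annihilator_valuedP[bl lb rb br] := bul_ann.
  by apply/(add_class_sum_tc starE) => a b c; rewrite bl lb rb br.
pose alpha := class_value (star_coef star).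
pose bul : {bilinear J K X -> J K X -> J K X} := star_sub alpha star.
have starE a b : star a b = bul a b + class_sum alpha a b by rewrite subrK.
have bul_ann : annihilator_valued (@J_mul K d X) bul.
  (* Total compatibility of [bul] equates its four nestings with [mul], so all of them vanish once
     [bl] holds. *)
  have bul_tc := (add_class_sum_tc starE).1 star_tc.
  have bl a b c : bul (J_mul a b) c = 0.
    by rewrite /= /star_sub star_mull // subrr.
  apply/annihilator_valuedP; split=> a b c; have [E1 E2 E3] := bul_tc a b c.
  - exact: bl.
  - by rewrite [LHS]/= -E1 bl.
  - by rewrite [LHS]/= -E2 -E1 bl.
  - by rewrite [LHS]/= -E3 -E2 -E1 bl.
exists bul, alpha; split=> //.
by split=> //; exact/(add_class_sumA starE bul_ann).
Qed.
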